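(* For all $n\ge2$, all $P,Q\in\Gamma_n$ and all real $t$ with $t\ge0$ or $t\le-1$, $$\Delta(P\Vert Q)\le\tfrac12\mathcal V_t(P\Vert Q).$$
   Context: $\Gamma_n=\{P=(p_1,\dots,p_n): p_i>0,\ \sum_{i=1}^n p_i=1\}$. For $P,Q\in\Gamma_n$, $\Delta(P\Vert Q)=\sum_{i=1}^n\frac{(p_i-q_i)^2}{p_i+q_i}$ (triangular discrimination) and $$\mathcal V_t(P\Vert Q)=\begin{cases}[t(t-1)]^{-1}\left[\sum_{i=1}^n\left(p_i^tq_i^{1-t}+p_i^{1-t}q_i^t\right)-2\right], & t\ne0,1,\\ \sum_{i=1}^n(p_i-q_i)\ln\left(\frac{p_i}{q_i}\right), & t=0,1.\end{cases}$$ *)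

(* Defs.v *)
From mathcomp Require Import all_boot all_order all_algebra.
From mathcomp Require Import classical_sets reals exp.

Set Implicit Arguments.
Unset Strict Implicit.
Unset Printing Implicit Defensive.

Import Order.TTheory GRing.Theory Num.Theory.

Local Open Scope classical_set_scope.
Local Open Scope ring_scope.

Definition Gamma (R : realType) (n : nat) : set ('I_n -> R) :=
  [set P | (forall i, 0 < P i) /\ \sum_(i < n) P i = 1].
Arguments Gamma : clear implicits.

Definition triangular_discrimination (R : realType) (n : nat)
    (P Q : 'I_n -> R) : R :=
  \sum_(i < n) (P i - Q i) ^+ 2 / (P i + Q i).

Definition Vdiv (R : realType) (n : nat) (t : R) (P Q : 'I_n -> R) : R :=
  if (t == 0) || (t == 1) then
    \sum_(i < n) (P i - Q i) * ln (P i / Q i)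
  else
    (t * (t - 1))^-1 *
    (\sum_(i < n) (P i `^ t * Q i `^ (1 - t) + P i `^ (1 - t) * Q i `^ t) - 2).

(* Main.v *)
Require Import Defs.
From mathcomp Require Import all_boot all_order all_algebra.
From mathcomp Require Import classical_sets reals exp.
From mathcomp Require Import topology normedtype derive realfun.
From mathcomp Require Import ring lra.

Import Order.TTheory GRing.Theory Num.Theory.
Import numFieldNormedType.Exports.

Set Implicit Arguments.
Unset Strict Implicit.

Local Open Scope classical_set_scope.
Local Open Scope ring_scope.

(** Both sides are Csiszar divergences: they have the form of a sum of
    [q_i * f (p_i / q_i)] for a generator [f] on the positive reals (for the
    right-hand side, the constant 2 is absorbed because [P] and [Q] both have
    mass one).  So it suffices to compare the generators pointwise.  Both vanish
    to first order at 1, hence it is enough to compare their second derivatives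
    ([convex_ge0]).  For the triangular discrimination this is [8 / (1 + x)^3];
    for the other side it is [(x^(t-2) + x^(-t-1)) / 2], a single formula which
    also covers the logarithmic cases [t = 0, 1].  The arithmetic-geometric mean
    inequality, used twice, puts [x^(-3/2)] between the two
    ([triangular_second_derivative_le]). *)

(** * A second-order criterion for nonnegativity *)

Lemma MVT_pos (R : realType) (f f' : R -> R) (a b : R) :
  (forall x : R, 0 < x -> is_derive x 1 f (f' x)) -> 0 < a -> a <= b ->
  exists2 c, a <= c <= b & f b - f a = f' c * (b - a).
Proof.
move=> df a0 ab.
have pos x : x \in `[a, b] -> 0 < x.
  by rewrite in_itv/= => /andP[+ _]; exact: lt_le_trans.
have [||c] := @MVT_segment R f f' a b ab.
- by move=> x /subset_itv_oo_cc/pos; exact: df.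
- apply: derivable_within_continuous => x /pos x0.
  by have [] := df x x0.
- by rewrite in_itv/= => cab E; exists c.
Qed.

(** Two applications of the mean value theorem: the first derivative has the
    sign of [x - a], so [f] decreases before [a] and increases after it. *)
Lemma convex_ge0 (R : realType) (f f' f'' : R -> R) (a x : R) :
  (forall y : R, 0 < y -> is_derive y 1 f (f' y)) ->
  (forall y : R, 0 < y -> is_derive y 1 f' (f'' y)) ->
  (forall y : R, 0 < y -> 0 <= f'' y) ->
  0 < a -> f a = 0 -> f' a = 0 -> 0 < x -> 0 <= f x.
Proof.
move=> df df' f''0 a0 fa f'a x0; have [ax|/ltW xa] := leP a x.
- have [c /andP[ac _]] := MVT_pos df a0 ax.
  rewrite fa subr0 => ->; apply: mulr_ge0; last by rewrite subr_ge0.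
  have [d /andP[ad _]] := MVT_pos df' a0 ac.
  rewrite f'a subr0 => ->; apply: mulr_ge0; last by rewrite subr_ge0.
  by apply: f''0; exact: lt_le_trans ad.
- have [c /andP[xc ca]] := MVT_pos df x0 xa.
  have c0 : 0 < c by exact: lt_le_trans xc.
  have [d /andP[cd _]] := MVT_pos df' c0 ca.
  rewrite fa f'a !sub0r => E' E.
  have f''d : 0 <= f'' d by apply: f''0; exact: lt_le_trans cd.
  have -> : f x = - f' c * (a - x) by lra.
  by rewrite E' !mulr_ge0 ?subr_ge0.
Qed.

(** * The generators and their derivatives *)

(** Equal to [(x - 1)^2 / (x + 1)], in the form that is easiest to
    differentiate. *)
Definition triangular_generator {R : realType} (x : R) : R :=
  x - 3 + 4 * (x + 1)^-1.

Definition triangular_generator' {R : realType} (x : R) : R :=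
  1 - 4 * (x + 1) ^- 2.

Definition V_generator {R : realType} (t x : R) : R :=
  if (t == 0) || (t == 1) then (x - 1) * ln x
  else (t * (t - 1))^-1 * (x `^ t + x `^ (1 - t) - x - 1).

Definition V_generator' {R : realType} (t x : R) : R :=
  if (t == 0) || (t == 1) then ln x + 1 - x^-1
  else (t * (t - 1))^-1 * (t * x `^ (t - 1) + (1 - t) * x `^ (- t) - 1).

Definition V_generator'' {R : realType} (t x : R) : R :=
  x `^ (t - 2) + x `^ (- t - 1).

Section Generators.
Context {R : realType}.
Implicit Types t x : R.

Lemma is_derive_triangular_generator x : 0 < x ->
  is_derive x 1 triangular_generator (triangular_generator' x).
Proof.
move=> x0; have x1 : x + 1 != 0 by lra.
rewrite /triangular_generator /triangular_generator'.
have dV : is_derive x 1 (fun y : R => (y + 1)^-1) (- (x + 1) ^- 2 *: (1 + 0)).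
  exact: (is_deriveV (f := fun y : R => y + 1)).
apply: is_derive_eq.
rewrite /GRing.scale/=; field; lra.
Qed.

Lemma is_derive_triangular_generator' x : 0 < x ->
  is_derive x 1 triangular_generator' (8 / (x + 1) ^+ 3).
Proof.
move=> x0; have x1 : (x + 1) ^+ 2 != 0 by rewrite expf_neq0//; lra.
rewrite /triangular_generator'.
have dX : is_derive x 1 (fun y : R => (y + 1) ^+ 2) (2 * (x + 1)).
  by apply: is_derive_eq; rewrite /GRing.scale/=; ring.
have dV := is_deriveV (f := fun y : R => (y + 1) ^+ 2) x1 dX.
apply: is_derive_eq.
rewrite /GRing.scale/=; field; lra.
Qed.

Lemma is_derive_V_generator t x : 0 < x ->
  is_derive x 1 (V_generator t) (V_generator' t x).
Proof.
move=> x0; rewrite /V_generator /V_generator'; case: ifPn => _.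
  have dl := is_derive1_ln x0.
  apply: is_derive_eq.
  rewrite /GRing.scale/=; field; lra.
have d1 := is_derive1_powR t x0; have d2 := is_derive1_powR (1 - t) x0.
apply: is_derive_eq.
have E : 1 - t - 1 = - t by ring.
by rewrite /GRing.scale/= E; ring.
Qed.

(** At [t = 0] and at [t = 1], one of the powers is [x^(-1)] and the other
    [x^(-2)], which gives the second derivative of [(x - 1) * ln x]; otherwise
    the factor [t * (t - 1)] cancels. *)
Lemma is_derive_V_generator' t x : 0 < x ->
  is_derive x 1 (V_generator' t) (V_generator'' t x).
Proof.
move=> x0; have xn0 : x != 0 by lra.
rewrite /V_generator' /V_generator''; case: (boolP ((t == 0) || (t == 1))) => [t01|].
  have -> : x `^ (t - 2) + x `^ (- t - 1) = x^-1 + x^-2.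
    have xN2 : x `^ (- 2) = x ^- 2 by apply: powR_invn; exact: ltW.
    have xN1 : x `^ (- 1) = x^-1 by apply: powR_inv1; exact: ltW.
    case/orP: t01 => /eqP ->.
      by rewrite oppr0 !sub0r xN2 xN1 addrC.
    have -> : 1 - 2 = -1 :> R by ring.
    have -> : -1 - 1 = - 2 :> R by ring.
    by rewrite xN1 xN2.
  have dl := is_derive1_ln x0.
  have dV : is_derive x 1 (fun y : R => y^-1) (- x ^- 2 *: 1).
    exact: (is_deriveV (f := fun y : R => y)).
  apply: is_derive_eq.
  rewrite /GRing.scale/=; field; lra.
rewrite negb_or => /andP[t0 t1].
have d1 := is_derive1_powR (t - 1) x0; have d2 := is_derive1_powR (- t) x0.
apply: is_derive_eq.
have E : t - 1 - 1 = t - 2 by ring.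
by rewrite /GRing.scale/= E; field; rewrite t0 subr_eq0 t1.
Qed.

(** * Comparison of the generators *)

(** With [A] and [B] the two powers, [A * B = x^(-3)], so
    [(A + B)^2 >= 4 x^(-3)], while [(x + 1)^2 >= 4 x]; squaring the claim avoids
    half-integer powers. *)
Lemma triangular_second_derivative_le t x : 0 < x ->
  8 / (x + 1) ^+ 3 <= 2^-1 * V_generator'' t x.
Proof.
move=> x0; rewrite /V_generator''.
have A0 : 0 < x `^ (t - 2) by exact: powR_gt0.
have B0 : 0 < x `^ (- t - 1) by exact: powR_gt0.
have AB : x `^ (t - 2) * x `^ (- t - 1) * x ^+ 3 = 1.
  rewrite -powRD; last by rewrite (gt_eqF x0) implybT.
  have -> : t - 2 + (- t - 1) = - 3%:R by ring.
  by rewrite powR_invn ?(ltW x0)// mulVf// expf_neq0// gt_eqF.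
move: (x `^ (t - 2)) (x `^ (- t - 1)) A0 B0 AB => A B A0 B0 AB.
have x10 : 0 < x + 1 by lra.
have y0 : 0 < (x + 1) ^+ 3 by exact: exprn_gt0.
have amx : (4 * x) ^+ 3 <= ((x + 1) ^+ 3) ^+ 2.
  rewrite -exprM mulnC exprM lerXn2r ?nnegrE//; [lra|exact: exprn_ge0 (ltW x10)|].
  by have := sqr_ge0 (x - 1); nra.
have amA : 4 * (A * B) <= (A + B) ^+ 2 by have := sqr_ge0 (A - B); nra.
rewrite ler_pdivrMr//.
suff : 16 <= (A + B) * (x + 1) ^+ 3 by lra.
have S0 : 0 <= (A + B) * (x + 1) ^+ 3 by rewrite mulr_ge0 ?ltW ?addr_gt0.
rewrite -(@ler_pXn2r R 2) ?nnegrE//.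
rewrite exprMn.
have -> : (16 : R) ^+ 2 = 4 * (A * B) * (4 * x) ^+ 3.
  have -> : 4 * (A * B) * (4 * x) ^+ 3 = 256 * (A * B * x ^+ 3) by ring.
  by rewrite AB; ring.
have AB0 : 0 <= A * B by rewrite mulr_ge0 ?ltW.
apply: ler_pM => //; first by rewrite mulr_ge0.
by rewrite exprn_ge0// mulr_ge0// ltW.
Qed.

Lemma triangular_generator_le t x : 0 < x ->
  triangular_generator x <= 2^-1 * V_generator t x.
Proof.
move=> x0; rewrite -subr_ge0.
pose f y := 2^-1 * V_generator t y - triangular_generator y.
pose f' y := 2^-1 * V_generator' t y - triangular_generator' y.
pose f'' y := 2^-1 * V_generator'' t y - 8 / (y + 1) ^+ 3.
apply: (@convex_ge0 R f f' f'' 1) => //.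
- move=> y y0; rewrite /f.
  have d1 := is_derive_V_generator t y0.
  by have d2 := is_derive_triangular_generator y0; exact: is_deriveB.
- move=> y y0; rewrite /f'.
  have d1 := is_derive_V_generator' t y0.
  by have d2 := is_derive_triangular_generator' y0; exact: is_deriveB.
- by move=> y y0; rewrite subr_ge0; exact: triangular_second_derivative_le.
- rewrite /f /V_generator /triangular_generator.
  case: ifPn => [_|]; first by rewrite subrr mul0r; field.
  by rewrite negb_or !powR1 => /andP[t0 t1]; field; rewrite t0 subr_eq0 t1.
- rewrite /f' /V_generator' /triangular_generator'.
  case: ifPn => [_|]; first by rewrite ln1; field.
  by rewrite negb_or !powR1 => /andP[t0 t1]; field; rewrite t0 subr_eq0 t1.
Qed.

(** * The divergences as sums of values of the generators *)

Lemma triangular_perspective (p q : R) : 0 < p -> 0 < q ->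
  (p - q) ^+ 2 / (p + q) = q * triangular_generator (p / q).
Proof.
move=> p0 q0; rewrite /triangular_generator; field.
by apply/andP; split; lra.
Qed.

Lemma powR_perspective (s p q : R) : 0 < p -> 0 < q ->
  q * (p / q) `^ s = p `^ s * q `^ (1 - s).
Proof.
move=> p0 q0; rewrite powRM ?invr_ge0 ?ltW// -powR_inv1 ?ltW// -powRrM mulN1r.
rewrite powRD; last by rewrite (gt_eqF q0) implybT.
by rewrite powRr1 ?ltW//; ring.
Qed.

(** The constant 2 is the total mass of [P] and [Q], so it can be distributed
    over the terms of the sum. *)
Lemma Vdiv_perspective (n : nat) t (P Q : 'I_n -> R) :
  Gamma R n P -> Gamma R n Q ->
  Vdiv t P Q = \sum_(i < n) Q i * V_generator t (P i / Q i).
Proof.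
move=> [P0 P1] [Q0 Q1]; rewrite /Vdiv /V_generator.
case: ifP => _.
  apply: eq_bigr => i _; have := Q0 i => q0.
  by rewrite mulrA mulrBr mulr1 mulrC [Q i * _]mulrC divfK ?gt_eqF// mulrC.
rewrite (_ : 2 = \sum_(i < n) (P i + Q i)); last by rewrite big_split/= P1 Q1.
rewrite -sumrB mulr_sumr; apply: eq_bigr => i _.
rewrite mulrCA; congr (_ * _).
rewrite !mulrBr mulrDr !powR_perspective// mulr1 subKr.
by rewrite mulrCA divff ?gt_eqF// mulr1 opprD addrA.
Qed.

End Generators.

Theorem mainTheorem11 :
  forall (R : realType) (n : nat), (2 <= n)%N ->
  forall P Q : 'I_n -> R, Gamma R n P -> Gamma R n Q ->
  forall t : R, 0 <= t \/ t <= -1 ->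
  triangular_discrimination P Q <= 2^-1 * Vdiv t P Q.
Proof.
move=> R n _ P Q GP GQ t _; rewrite Vdiv_perspective// mulr_sumr.
have [P0 _] := GP; have [Q0 _] := GQ.
apply: ler_sum => i _; rewrite triangular_perspective// mulrCA.
rewrite ler_pM2l//; apply: triangular_generator_le.
exact: divr_gt0.
Qed.
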